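(* Let $A=K[a_1,\ldots,a_n]$ be a solvable polynomial algebra with admissible system $(\mathcal{B},\prec)$. Then every finitely generated left $A$-module $M$ has a finite free resolution $$0\to L_q\xrightarrow{\varphi_q}L_{q-1}\xrightarrow{\varphi_{q-1}}\cdots\xrightarrow{\varphi_1}L_0\xrightarrow{\varphi_0}M\to 0$$ such that $q\le n$.
   Context: $K$ is a field, $K^*=K\setminus\{0\}$, $\mathbb{N}$ is the set of nonnegative integers; algebras are associative unital $K$-algebras. Solvable polynomial algebras. Let $A=K[a_1,\ldots,a_n]$ be a $K$-algebra generated by $a_1,\ldots,a_n$, no proper subset of which generates $A$. $A$ has the PBW $K$-basis $\mathcal{B}$ if $\mathcal{B}=\{a^\alpha=a_1^{\alpha_1}\cdots a_n^{\alpha_n}\mid \alpha=(\alpha_1,\ldots,\alpha_n)\in\mathbb{N}^n\}$ is a $K$-basis of $A$. For a total ordering $\prec$ on $\mathcal{B}$, $\mathrm{LM}(f)$ is the $\prec$-largest basis element occurring in a nonzero $f\in A$ (and $\mathrm{LM}(0)=0$). A monomial ordering on $\mathcal{B}$ is a total ordering $\prec$ such that: (1) $\prec$ is a well-ordering; (2) if $a^\gamma\ne1$, $a^\beta\ne a^\gamma$ and $a^\gamma=\mathrm{LM}(a^\alpha a^\beta a^\eta)$, then $a^\beta\prec a^\gamma$; (3) if $a^\alpha\prec a^\beta$, $\mathrm{LM}(a^\gamma a^\alpha a^\eta)\ne 0$ and $\mathrm{LM}(a^\gamma a^\beta a^\eta)\notin\{0,1\}$, then $\mathrm{LM}(a^\gamma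 a^\alpha a^\eta)\prec\mathrm{LM}(a^\gamma a^\beta a^\eta)$. $A$ is a solvable polynomial algebra with admissible system $(\mathcal{B},\prec)$ if $\mathcal{B}$ is a $K$-basis of $A$, $\prec$ is a monomial ordering on $\mathcal{B}$, and for all $\alpha,\beta\in\mathbb{N}^n$, $a^\alpha a^\beta=\lambda_{\alpha,\beta}a^{\alpha+\beta}+f_{\alpha,\beta}$ with $\lambda_{\alpha,\beta}\in K^*$ and $f_{\alpha,\beta}\in A$ satisfying $f_{\alpha,\beta}=0$ or $\mathrm{LM}(f_{\alpha,\beta})\prec a^{\alpha+\beta}$. A finite free resolution of a finitely generated left $A$-module $M$ is an exact sequence as displayed in which every $L_i$ is a free left $A$-module of finite rank; $q$ is its length. *)

(* Defs.v *)
From HB Require Import structures.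
From mathcomp Require Import all_boot all_order all_algebra.
From mathcomp Require Import mpoly.

Set Implicit Arguments.
Unset Strict Implicit.
Unset Printing Implicit Defensive.

Import GRing.Theory.
Local Open Scope ring_scope.

Section SolvablePolynomialAlgebra.
Variables (K : fieldType) (A : algType K) (n : nat) (a : 'I_n -> A).

Definition generates (J : {set 'I_n}) : Prop :=
  forall S : {pred A}, GRing.subalg_closed S ->
    (forall i, i \in J -> a i \in S) -> forall x, x \in S.

Definition minimally_generates : Prop :=
  generates [set: 'I_n] /\
  forall J : {set 'I_n}, J \proper [set: 'I_n] -> ~ generates J.

(* [mmap1 a m] is the product of the [a i ^+ m i] in increasing order of the
   index i; the order matters as A need not be commutative. *)
Definition monomial (m : 'X_{1..n}) : A := mmap1 a m.

(* [{mpoly K[n]}] only serves as the type of finitely supported functions from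
   exponents to K: the ring structure of A is not that of [{mpoly K[n]}]. *)
Definition lincomb (c : {mpoly K[n]}) : A :=
  \sum_(m <- msupp c) c@_m *: monomial m.

(* The family of monomials, indexed by all exponents, is a K-basis; in
   particular distinct exponents give distinct monomials. *)
Definition pbw_basis : Prop :=
  (forall f : A, exists c : {mpoly K[n]}, f = lincomb c) /\
  (forall c : {mpoly K[n]}, lincomb c = 0 -> c = 0).

(* A strict order on the set of monomials is given as a relation on exponents,
   which index the monomials bijectively when [pbw_basis] holds. *)
Variable prec : rel 'X_{1..n}.

(* [is_LM f m] says LM(f) = a^m. The convention LM(0) = 0 corresponds to
   [is_LM 0 m] holding for no m, so "LM(f) <> 0" is "[is_LM f m] for some m". *)
Definition is_LM (f : A) (m : 'X_{1..n}) : Prop :=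
  exists c : {mpoly K[n]}, [/\ f = lincomb c, m \in msupp c &
    forall m', m' \in msupp c -> m' != m -> prec m' m].

Definition strict_total_order : Prop :=
  [/\ irreflexive prec, transitive prec &
      forall m1 m2, m1 != m2 -> prec m1 m2 || prec m2 m1].

Record monomial_ordering : Prop := MonomialOrdering {
  mo_total : strict_total_order;
  mo_wf : well_founded prec;
  mo_factor : forall al be ga et : 'X_{1..n},
    monomial ga != 1 -> monomial be != monomial ga ->
    is_LM (monomial al * monomial be * monomial et) ga ->
    prec be ga;
  mo_compat : forall al be ga et mu nu : 'X_{1..n},
    prec al be ->
    is_LM (monomial ga * monomial al * monomial et) mu ->
    is_LM (monomial ga * monomial be * monomial et) nu ->
    monomial nu != 1 ->
    prec mu nu
}.

Record solvable_polynomial_algebra : Prop := SolvablePolynomialAlgebra {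
  spa_gen : minimally_generates;
  spa_basis : pbw_basis;
  spa_order : monomial_ordering;
  spa_mul : forall al be : 'X_{1..n}, exists (la : K) (f : A),
    [/\ la != 0,
        monomial al * monomial be = la *: monomial (al + be)%MM + f &
        f = 0 \/ exists2 m, is_LM f m & prec m (al + be)%MM]
}.

End SolvablePolynomialAlgebra.

Section Resolutions.
Variable A : nzRingType.

Definition finitely_generated (M : lmodType A) : Prop :=
  exists (m : nat) (g : 'I_m -> M),
    forall x : M, exists c : 'I_m -> A, x = \sum_(i < m) c i *: g i.

Definition free_of_finite_rank (L : lmodType A) : Prop :=
  exists (r : nat) (e : 'I_r -> L),
    forall x : L, exists! c : {ffun 'I_r -> A}, x = \sum_(i < r) c i *: e i.

(* The target of the i-th map of a resolution: M if i = 0, L_(i-1) otherwise. *)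
Definition res_target (M : lmodType A) (L : nat -> lmodType A) (i : nat) :
    lmodType A :=
  if i is j.+1 then L j else M.

(* 0 -> L_q -> ... -> L_0 -> M -> 0. The modules L i and the maps phi i with
   q < i are irrelevant and unconstrained. *)
Record finite_free_resolution (M : lmodType A) (q : nat)
    (L : nat -> lmodType A)
    (phi : forall i, {linear L i -> res_target M L i}) : Prop :=
  FiniteFreeResolution {
    ffr_free : forall i, (i <= q)%N -> free_of_finite_rank (L i);
    ffr_surj : forall y : M, exists x : L 0%N, phi 0%N x = y;
    ffr_exact : forall i, (i < q)%N -> forall x : L i,
      phi i x = 0 <-> exists y : L i.+1, phi i.+1 y = x;
    ffr_inj : injective (phi q)
  }.

End Resolutions.

(* Main.v *)
(* Schreyer's proof of Hilbert's syzygy theorem, without S-polynomials. Given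
   the kernel N of a map from a free module, choose elements of N whose leading
   monomials l_0, l_1, ... are the minimal leading monomials of N; by division
   they generate N. For Schreyer's order, the leading monomials of their module
   of syzygies are exactly the a^u e_j such that l_i divides a^u l_j for some
   i > j: the difference of the two multiples has a smaller leading monomial
   and is rewritten by division. If the first k variables do not occur in the
   l_j, and the l_j are listed by decreasing degree in the next variable, then
   that variable drops out too, and by minimality no e_j is itself a leading
   monomial. After n steps the leading monomials of the syzygies are generated
   by those without any variable, that is by basis elements e_j; hence there are
   none. If n = 0 no step is made, and A = K requires a separate argument. *)
From HB Require Import structures.
From Stdlib Require Import Classical Inverse_Image.
Require Import Defs.
From mathcomp Require Import all_boot all_order all_algebra.
From mathcomp Require Import mpoly.

Set Implicit Arguments.
Unset Strict Implicit.
Unset Printing Implicit Defensive.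

Import GRing.Theory.
Local Open Scope ring_scope.

(** * Divisibility of monomials in free modules, Dickson's lemma, minimal elements *)

Section Exponents.
Variables (n : nat).

(** If [p] is the leading monomial of a vector, this is the leading monomial of its multiple by the
    monomial with exponent [u]; see [lead_monomial_scale]. *)
Definition shift r (u : 'X_{1..n}) (p : 'X_{1..n} * 'I_r) := ((u + p.1)%MM, p.2).

Definition divides r (p q : 'X_{1..n} * 'I_r) := (p.2 == q.2) && (p.1 <= q.1)%MM.

Lemma dividesP r (p q : 'X_{1..n} * 'I_r) :
  reflect (exists u, q = shift u p) (divides p q).
Proof.
apply: (iffP andP) => [[/eqP e le_pq]|[u ->]]; last by rewrite lem_addl.
by exists (q.1 - p.1)%MM; rewrite /shift submK // e; case: (q).
Qed.

Lemma divides_refl r : reflexive (@divides r).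
Proof. by move=> p; rewrite /divides eqxx lepm_refl. Qed.

Lemma divides_trans r : transitive (@divides r).
Proof.
move=> q p s /andP[/eqP e1 l1] /andP[/eqP e2 l2].
by rewrite /divides e1 e2 eqxx (lepm_trans l1 l2).
Qed.

(** The finite bases are concatenated. This serves for the slices in Dickson's lemma and for the
    components of a free module. *)
Lemma finite_union_bases (T : eqType) (I : eqType) (R : T -> T -> Prop)
    (P : I -> T -> Prop) (s : seq I) :
  (forall i, i \in s -> exists B : seq T,
     (forall b, b \in B -> P i b) /\
     forall x, P i x -> exists2 b, b \in B & R b x) ->
  exists B : seq T,
    (forall b, b \in B -> exists2 i, i \in s & P i b) /\
    forall i x, i \in s -> P i x -> exists2 b, b \in B & R b x.
Proof.
elim: s => [|i s IH] Hs; first by exists [::].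
have [B [BP Bx]] := Hs i (mem_head _ _).
have [|C [CP Cx]] := IH; first by move=> j js; apply: Hs; rewrite in_cons js orbT.
exists (B ++ C); split.
  move=> b; rewrite mem_cat => /orP[/BP Pb|/CP[j js Pb]].
    by exists i; rewrite ?mem_head.
  by exists j; rewrite // in_cons js orbT.
move=> j x; rewrite in_cons => /orP[/eqP->|js] Px.
  by have [b bB Rb] := Bx _ Px; exists b; rewrite // mem_cat bB.
by have [b bB Rb] := Cx _ _ js Px; exists b; rewrite // mem_cat bB orbT.
Qed.

(* Dickson's lemma, by induction on the set of coordinates that vary in P: an
   element of P that is not above a given z lies in one of the finitely many
   slices where a coordinate i equals some v < z i. *)
Lemma dickson (T : {set 'I_n}) (P : 'X_{1..n} -> Prop) :
  (forall x y, P x -> P y -> forall i, i \notin T -> x i = y i) ->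
  exists B : seq 'X_{1..n}, (forall b, b \in B -> P b) /\
    forall x, P x -> exists2 b, b \in B & (b <= x)%MM.
Proof.
move: {2}#|T| (erefl #|T|) => d; elim: d T P => [|d IH] T P cT HP.
  have [[z Pz]|nP] := classic (exists z, P z); last first.
    by exists [::]; split=> // x Px; case: nP; exists x.
  exists [:: z]; split=> [b|x Px]; first by rewrite inE => /eqP->.
  exists z; rewrite ?mem_head //; apply/mnm_lepP => i.
  by rewrite (HP z x Pz Px) // (cards0_eq cT) inE.
have [[z Pz]|nP] := classic (exists z, P z); last first.
  by exists [::]; split=> // x Px; case: nP; exists x.
pose Q (iv : 'I_n * nat) x := P x /\ x iv.1 = iv.2.
pose s := [seq (i, v) | i <- enum T, v <- iota 0 (z i)].
have [|B [BP Bx]] := @finite_union_bases _ _ (fun b x => (b <= x)%MM) Q s.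
  move=> [i v] /allpairsPdep[j [w [jT _ [-> ->]]]].
  rewrite mem_enum in jT.
  apply: (IH (T :\ j)); first by move: cT; rewrite (cardsD1 j) jT => -[].
  move=> x y [Px xj] [Py yj] k; rewrite in_setD1 negb_and negbK => /orP[/eqP->|].
    by rewrite xj yj.
  exact: HP.
exists (z :: B); split=> [b|x Px].
  by rewrite in_cons => /orP[/eqP->|/BP[i _ []]].
have [le_zx|] := boolP (z <= x)%MM; first by exists z; rewrite ?mem_head.
move=> /mnm_lepP nle; have [i lt_xz] : exists i, (x i < z i)%N.
  apply: NNPP => nex; apply: nle => i; rewrite leqNgt; apply/negP => lt_xz.
  by apply: nex; exists i.
have iT : i \in T.
  by apply/negPn/negP => /(HP x z Px Pz) e; rewrite e ltnn in lt_xz.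
have [||b bB le_bx] := Bx (i, x i) x; last by exists b; rewrite // in_cons bB orbT.
- by apply/allpairsPdep; exists i, (x i); rewrite mem_enum mem_iota.
- by [].
Qed.

(** [P] is not boolean, so excluded middle decides each entry in turn. *)
Lemma seq_filter_Prop (T : eqType) (P : T -> Prop) (s : seq T) :
  exists2 t, uniq t & forall x, x \in t <-> x \in s /\ P x.
Proof.
elim: s => [|y s [t ut Ht]]; first by exists [::] => // x; split=> // -[].
have [[Py yt]|nPy] := classic (P y /\ y \notin t).
  exists (y :: t); first by rewrite /= yt.
  move=> x; rewrite !in_cons; split=> [/orP[/eqP->|/Ht[-> Px]]|].
  - by rewrite eqxx.
  - by rewrite orbT.
  - by move=> [/orP[->//|xs] Px]; apply/orP; right; apply/Ht.
exists t => // x; split=> [/Ht[xs Px]|]; first by rewrite in_cons xs orbT.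
rewrite in_cons => -[/orP[/eqP->|xs] Px]; last exact/Ht.
by case: (boolP (y \in t)) => // yt; case: nPy.
Qed.

Definition minimal r (P : 'X_{1..n} * 'I_r -> Prop) p :=
  P p /\ forall q, P q -> divides q p -> q = p.

(** A proper divisor has smaller total degree, so a descent inside [P] stops. *)
Lemma minimal_below r (P : 'X_{1..n} * 'I_r -> Prop) p :
  P p -> exists2 q, minimal P q & divides q p.
Proof.
have [d] := ubnP (mdeg p.1); elim: d p => // d IH p /ltnSE-le_d Pp.
have [mp|nmp] := classic (minimal P p); first by exists p; rewrite ?divides_refl.
have [q [Pq qp neq]] : exists q, [/\ P q, divides q p & q <> p].
  apply: NNPP => nex; apply: nmp; split=> // q Pq qp.
  by apply: NNPP => neq; apply: nex; exists q.
have [|//|t mt tq] := IH q _; last by exists t => //; apply: divides_trans qp.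
apply: leq_trans le_d.
move/dividesP: qp neq => [u ->]; rewrite /shift mdegD.
have [->|u0 _] := eqVneq u 0%MM; first by rewrite add0m; case: (q).
by rewrite -[ltnLHS]add0n ltn_add2r lt0n mdeg_eq0.
Qed.

(** Dickson's lemma gives a finite basis in each component; a minimal element is divisible by a
    basis element, hence equal to it. *)
Lemma minimal_elements r (P : 'X_{1..n} * 'I_r -> Prop) :
  exists2 s, uniq s & forall p, p \in s <-> minimal P p.
Proof.
have [|B [BP Bx]] := @finite_union_bases _ _
    (@divides r) (fun i p => P p /\ p.2 = i) (enum 'I_r).
  move=> i _; have [|B [BP Bx]] := @dickson setT (fun m => P (m, i)).
    by move=> x y _ _ j; rewrite inE.
  exists [seq (m, i) | m <- B]; split=> [b /mapP[m /BP ? ->]//|[m j] [/= Pm e]].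
  rewrite e in Pm *; have [b bB le_bm] := Bx _ Pm.
  by exists (b, i); [apply: map_f | rewrite /divides eqxx].
have [t ut Ht] := @seq_filter_Prop _ (minimal P) B; exists t => // p.
rewrite Ht; split=> [[]//|mp]; split=> //.
have [||b bB bp] := Bx p.2 p; rewrite ?mem_enum //; first by case: mp.
by have [i _ [Pb _]] := BP b bB; case: (mp) => _ /(_ b Pb bp) <-.
Qed.


(** * Well-orders on the monomials of free modules *)

Definition admissible (prec : rel 'X_{1..n}) :=
  [/\ strict_total_order prec, well_founded prec &
      forall u v w, prec u v -> prec (w + u)%MM (w + v)%MM].

(* The pair (m, i) stands for the element a^m e_i of a free module of rank r. *)
Record compatible_order (prec : rel 'X_{1..n}) r (lt : rel ('X_{1..n} * 'I_r)) : Prop :=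
  CompatibleOrder {
  co_irr : irreflexive lt;
  co_trans : transitive lt;
  co_total : forall p q, p != q -> lt p q || lt q p;
  co_wf : well_founded lt;
  co_shift : forall u p q, lt p q -> lt (shift u p) (shift u q);
  co_prec : forall u v i, prec u v -> lt (u, i) (v, i)
}.

Lemma shiftA r u v (p : 'X_{1..n} * 'I_r) : shift u (shift v p) = shift (u + v)%MM p.
Proof. by rewrite /shift addmA. Qed.

Lemma shiftI r (p : 'X_{1..n} * 'I_r) : injective (fun u => shift u p).
Proof. by move=> u v /(congr1 fst) /= e; apply: (can_inj (addmK p.1)) e. Qed.

Lemma base_order_compatible prec : admissible prec ->
  @compatible_order prec 1 (fun p q => prec p.1 q.1).
Proof.
case=> -[irr tr tot] wf mon; split.
- by move=> p; apply: irr.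
- by move=> q p s; apply: tr.
- move=> [u i] [v j] neq; apply: tot; apply: contra neq => /= /eqP->.
  by rewrite !ord1.
- exact: (@wf_inverse_image _ _ prec fst wf).
- by move=> u p q; apply: mon.
- by [].
Qed.

(* Schreyer's order on the free module with basis (e_j), where e_j is to be
   mapped to an element with leading monomial l j. *)
Definition schreyer r s (lt : rel ('X_{1..n} * 'I_r)) (l : 'I_s -> 'X_{1..n} * 'I_r) :
    rel ('X_{1..n} * 'I_s) :=
  fun p q => lt (shift p.1 (l p.2)) (shift q.1 (l q.2)) ||
    (shift p.1 (l p.2) == shift q.1 (l q.2)) && (q.2 < p.2)%N.

Lemma schreyer_compatible prec r s (lt : rel ('X_{1..n} * 'I_r))
    (l : 'I_s -> 'X_{1..n} * 'I_r) :
  admissible prec -> compatible_order prec lt ->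
  compatible_order prec (schreyer lt l).
Proof.
case=> _ _ mon [irr tr tot wf sh pr]; rewrite /schreyer; split.
- by move=> p; rewrite irr ltnn andbF.
- move=> q p t /orP[lt1|/andP[/eqP-> o1]] /orP[lt2|/andP[/eqP<- o2]].
  + by rewrite (tr _ _ _ lt1 lt2).
  + by rewrite lt1.
  + by rewrite lt2.
  + by rewrite eqxx (ltn_trans o2 o1) orbT.
- move=> p q neq; have [e|] := eqVneq (shift p.1 (l p.2)) (shift q.1 (l q.2)).
    rewrite -e irr /=; case: ltngtP => //= /val_inj e2; case/negP: neq.
    case: p q e e2 => [u i] [v j] /= e e2; rewrite e2 in e.
    by rewrite (shiftI e) e2.
  by move=> /tot /orP[]->; rewrite ?orbT.
(* The outer induction is on the shifted monomial, the inner one on [s - p.2]: within a tie, going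
   down raises the index. *)
- move=> p; move: {2}(shift _ _) (erefl (shift p.1 (l p.2))) => x.
  elim/(well_founded_ind wf): x p => x IHx p.
  have [d] := ubnP (s - p.2); elim: d p => [p|d IHd p /ltnSE-le_d px]; first by rewrite ltn0.
  apply: Acc_intro => q /orP[lt_qp|/andP[/eqP eq_qp lt_pq]].
    by apply: IHx (erefl _); rewrite -px.
  apply: IHd; last by rewrite eq_qp.
  by apply: leq_trans le_d; apply: ltn_sub2l => //; apply: ltn_trans (ltn_ord q.2).
- move=> u p q; rewrite /= -!shiftA => /orP[/sh->//|/andP[/eqP-> ->]].
  by rewrite eqxx orbT.
- by move=> u v i /(mon _ _ (l i).1); rewrite /= ![((l i).1 + _)%MM]addmC => /pr->.
Qed.

End Exponents.

(** * Coordinates and leading monomials in free modules over A *)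

Section LeadingMonomials.
Variables (K : fieldType) (A : algType K) (n : nat) (a : 'I_n -> A).
Hypothesis basis : pbw_basis a.

Lemma lincomb_mmap c : lincomb a c = mmap (in_alg A) a c.
Proof. by apply: eq_bigr => m _; rewrite mulr_algl. Qed.

Lemma lincombX m : lincomb a 'X_[m] = monomial a m.
Proof. by rewrite lincomb_mmap mmapX. Qed.

Lemma lincomb_inj : injective (lincomb a).
Proof.
move=> c d e; apply/eqP; rewrite -subr_eq0; apply/eqP/(proj2 basis).
by move: e; rewrite !lincomb_mmap mmapB => ->; rewrite subrr.
Qed.

Lemma lincomb_onto x : exists c, lincomb a c == x.
Proof. by have [c ->] := proj1 basis x; exists c. Qed.

(** The inverse of [lincomb a]: the PBW coordinates of [x], stored as a polynomial. *)
Definition coef x := xchoose (lincomb_onto x).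

Lemma coefK x : lincomb a (coef x) = x.
Proof. exact/eqP/(xchooseP (lincomb_onto x)). Qed.

Lemma lincombK c : coef (lincomb a c) = c.
Proof. by apply: lincomb_inj; rewrite coefK. Qed.

Lemma coef_is_linear : linear coef.
Proof.
move=> k x y; apply: lincomb_inj.
by rewrite coefK !lincomb_mmap mmapD mmapZ -!lincomb_mmap !coefK mulr_algl.
Qed.
HB.instance Definition _ := GRing.isLinear.Build K A {mpoly K[n]} _ coef coef_is_linear.

Lemma coefZ k x : coef (k *: x) = k *: coef x.
Proof. exact: linearZ. Qed.

Lemma coef_monomial m : coef (monomial a m) = 'X_[m].
Proof. by rewrite -lincombX lincombK. Qed.

Lemma coef_sum_monomials x : x = \sum_(m <- msupp (coef x)) (coef x)@_m *: monomial a m.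
Proof. by rewrite -[LHS]coefK. Qed.

Local Notation free r := {ffun 'I_r -> A^o}.

Section Coordinates.
Variable r : nat.
Implicit Types (v w : free r) (p q : 'X_{1..n} * 'I_r).

Definition coord p v : K := (coef (v p.2))@_(p.1).

Lemma coord_is_additive p : {morph coord p : v w / v - w}.
Proof. by move=> v w; rewrite /coord !ffunE raddfB mcoeffB. Qed.
HB.instance Definition _ p := GRing.isZmodMorphism.Build (free r) K (coord p) (coord_is_additive p).

(** The free module is a module over A, so scalars of K act through [k%:A]. *)
Lemma coordZ p k v : coord p (k%:A *: v) = k * coord p v.
Proof.
rewrite /coord ffunE -mcoeffZ -linearZ; congr (coef _)@_ _.
by rewrite /GRing.scale /= mulr_algl.
Qed.

Lemma coord_scale p x v : coord p (x *: v) =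
  \sum_(m <- msupp (coef x)) (coef x)@_m * coord p (monomial a m *: v).
Proof.
rewrite {1}[x]coef_sum_monomials scaler_suml raddf_sum; apply: eq_bigr => m _.
by rewrite -coordZ scalerA mulr_algl.
Qed.

Lemma coord_monomial_scale p u v : coord p (monomial a u *: v) =
  \sum_(m <- msupp (coef (v p.2)))
     (coef (v p.2))@_m * (coef (monomial a u * monomial a m))@_(p.1).
Proof.
rewrite {1}/coord ffunE {1}/GRing.scale /= {1}[v p.2]coef_sum_monomials.
rewrite mulr_sumr !raddf_sum; apply: eq_bigr => m _.
by rewrite /= -scalerAr coefZ mcoeffZ.
Qed.

Definition support v := [seq (m, i) | i <- enum 'I_r, m <- msupp (coef (v i))].

Lemma mem_support p v : (p \in support v) = (coord p v != 0).
Proof.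
rewrite /coord -mcoeff_msupp; apply/allpairsPdep/idP => [[i [m [_ im ->]]] //|].
by exists p.2, p.1; rewrite mem_enum -surjective_pairing.
Qed.

Lemma coord_eq0 v : (forall p, coord p v = 0) -> v = 0.
Proof.
move=> v0; apply/ffunP => i; rewrite ffunE -[v i]coefK.
suff -> : coef (v i) = 0 by rewrite lincomb_mmap mmap0.
by apply/mpolyP => m; rewrite mcoeff0; apply: (v0 (m, i)).
Qed.

Definition unit_vector (i : 'I_r) : free r := [ffun j => (j == i)%:R].

Lemma coord_unit_vector p u i :
  coord p (monomial a u *: unit_vector i) = (p == (u, i))%:R.
Proof.
case: p => m j; rewrite /coord !ffunE /= {1}/GRing.scale /= xpair_eqE.
case: (j == i); last by rewrite mulr0 linear0 mcoeff0 andbF.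
by rewrite mulr1 coef_monomial mcoeffX andbT eq_sym.
Qed.

Lemma sum_unit_vectors v : v = \sum_i v i *: unit_vector i.
Proof.
apply/ffunP => j; rewrite sum_ffunE (bigD1 j) //= big1 => [|i ij].
  by rewrite !ffunE eqxx /GRing.scale /= mulr1 addr0.
by rewrite !ffunE eq_sym (negbTE ij) scaler0.
Qed.

End Coordinates.

Section Combinations.
Variables (r : nat) (M : lmodType A) (g : 'I_r -> M).

Definition comb (v : free r) : M := \sum_i v i *: g i.

Lemma comb_is_linear : linear comb.
Proof.
move=> x v w; rewrite /comb scaler_sumr -big_split; apply: eq_bigr => i _.
by rewrite !ffunE scalerDl scalerA.
Qed.
HB.instance Definition _ := GRing.isLinear.Build A (free r) M _ comb comb_is_linear.

Lemma comb_unit_vector i : comb (unit_vector i) = g i.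
Proof.
rewrite /comb (bigD1 i) //= ffunE eqxx scale1r big1 ?addr0 // => j ji.
by rewrite ffunE (negbTE ji) scale0r.
Qed.

End Combinations.

Section Lead.
Variables (prec : rel 'X_{1..n}).
(** All that leading monomials require of the multiplication of A; it is established below for
    solvable polynomial algebras. *)
Hypothesis lead_mul : forall u v,
  (coef (monomial a u * monomial a v))@_(u + v) != 0 /\
  forall m, (coef (monomial a u * monomial a v))@_m != 0 ->
     m = (u + v)%MM \/ prec m (u + v)%MM.

Variable r : nat.
Variable lt : rel ('X_{1..n} * 'I_r).
Hypothesis lt_ok : compatible_order prec lt.
Implicit Types (v w : free r) (p q : 'X_{1..n} * 'I_r).

Definition lead v p := coord p v != 0 /\ forall q, coord q v != 0 -> (q == p) || lt q p.

Lemma seq_max (s : seq ('X_{1..n} * 'I_r)) p0 : p0 \in s ->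
  exists2 p, p \in s & forall q, q \in s -> (q == p) || lt q p.
Proof.
case: lt_ok => irr tr tot _ _ _; elim: s p0 => // x s IH p0 _.
case: s IH => [_|y s /(_ y (mem_head _ _)) [p ps pmax]].
  by exists x; rewrite ?mem_head // => q; rewrite inE => ->.
have [->|/tot /orP[xp|px]] := eqVneq x p.
- by exists p; rewrite ?mem_head // => q; rewrite in_cons => /orP[->|/pmax].
- exists p; first by rewrite in_cons ps orbT.
  by move=> q; rewrite in_cons => /orP[/eqP->|/pmax//]; rewrite xp orbT.
exists x; rewrite ?mem_head // => q; rewrite in_cons => /orP[->//|/pmax/orP[/eqP->|qp]].
  by rewrite px orbT.
by rewrite (tr _ _ _ qp px) orbT.
Qed.

Lemma lead_exists v : v <> 0 -> exists p, lead v p.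
Proof.
move=> v0; have [p0 vp0] : exists p, coord p v != 0.
  apply: NNPP => nex; apply: v0; apply: coord_eq0 => p; apply/eqP/negPn/negP => vp.
  by apply: nex; exists p.
have [|p pv pmax] := @seq_max (support v) p0; first by rewrite mem_support.
by exists p; split=> [|q]; rewrite -mem_support //; apply: pmax.
Qed.

(** A term of [v] below [p] contributes only monomials at most its own shift, which is below
    [shift u p]. So the coordinate there is a product of two nonzero elements of K. *)
Lemma lead_monomial_scale u v p : lead v p -> lead (monomial a u *: v) (shift u p).
Proof.
case: lt_ok => irr tr tot _ sh pr [vp vmax]; split.
  rewrite coord_monomial_scale (bigD1_seq p.1) ?msupp_uniq ?mcoeff_msupp //=.
  rewrite big1_seq ?addr0 ?mulf_neq0 //; first by case: (lead_mul u p.1).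
  move=> m /andP[mp]; rewrite mcoeff_msupp => vm0.
  apply/eqP/negPn/negP; rewrite mulf_eq0 negb_or => /andP[_].
  have vm : lt (m, p.2) p.
    by case/orP: (vmax (m, p.2) vm0) mp => // /eqP <-; rewrite eqxx.
  case/(lead_mul u m).2 => [/addmI e|/pr lt1]; first by rewrite e eqxx in mp.
  by move: (sh u _ _ vm) (lt1 p.2) => /tr t /t; rewrite irr.
move=> q; rewrite coord_monomial_scale => q0.
(* A monomial [q] of the product must come from some term [(m, q.2)] of [v]. *)
have [m vm um] : exists2 m, coord (m, q.2) v != 0 &
    (coef (monomial a u * monomial a m))@_(q.1) != 0.
  apply: NNPP => nex; case/eqP: q0; rewrite big1_seq // => m.
  rewrite mcoeff_msupp => /= vm; apply/eqP; rewrite mulf_eq0.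
  by apply/orP; right; apply/negPn/negP => um; apply: nex; exists m.
have qm : (q == shift u (m, q.2)) || lt q (shift u (m, q.2)).
  rewrite [q in q == _]surjective_pairing [q in lt q _]surjective_pairing.
  by have [->|/pr ->] := (lead_mul u m).2 _ um; rewrite ?eqxx ?orbT.
case/orP: (vmax _ vm) => [/eqP e|/(sh u) mp]; first by rewrite -e.
by case/orP: qm => [/eqP->|/tr/(_ mp)->]; rewrite ?mp orbT.
Qed.

End Lead.
End LeadingMonomials.

(** * Leading monomials of products and the ordering on exponents *)

Section SolvableFacts.
Variables (K : fieldType) (A : algType K) (n : nat) (a : 'I_n -> A).
Variable prec : rel 'X_{1..n}.
Hypothesis hA : solvable_polynomial_algebra a prec.
Let basis := spa_basis hA.

Lemma monomial_inj : injective (monomial a).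
Proof.
move=> u v e; have : ('X_[u] : {mpoly K[n]}) = 'X_[v].
  by apply: (lincomb_inj basis); rewrite !lincombX.
by move/(congr1 (mcoeff v)); rewrite !mcoeffX eqxx; case: eqP => // _ /eqP; rewrite eq_sym oner_eq0.
Qed.

Lemma monomial0 : monomial a 0%MM = 1.
Proof. exact: mmap11. Qed.

Lemma is_LMP x m : is_LM a prec x m <->
  (coef basis x)@_m != 0 /\ forall u, (coef basis x)@_u != 0 -> u = m \/ prec u m.
Proof.
split=> [[c [-> mc cmax]]|[xm xmax]].
  rewrite lincombK -mcoeff_msupp; split=> // u; rewrite -mcoeff_msupp => /cmax.
  by case: (eqVneq u m) => [->|_ /(_ isT)]; [left | right].
exists (coef basis x); rewrite coefK mcoeff_msupp; split=> // u.
by rewrite mcoeff_msupp => /xmax[->|//]; rewrite eqxx.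
Qed.

Lemma lead_mul u v :
  (coef basis (monomial a u * monomial a v))@_(u + v) != 0 /\
  forall m, (coef basis (monomial a u * monomial a v))@_m != 0 ->
     m = (u + v)%MM \/ prec m (u + v)%MM.
Proof.
have [[irr tr _] _ _ _] := spa_order hA.
have [k [x [k0 -> Hx]]] := spa_mul hA u v.
have xE m : (coef basis (k *: monomial a (u + v) + x))@_m =
    k * (m == (u + v)%MM)%:R + (coef basis x)@_m.
  by rewrite raddfD /= coefZ coef_monomial mcoeffD mcoeffZ mcoeffX eq_sym.
have x_low m : (coef basis x)@_m != 0 -> prec m (u + v)%MM.
  case: Hx => [->|[w /is_LMP[_ xmax] wuv]]; first by rewrite raddf0 mcoeff0 eqxx.
  by move/xmax => [->//|/tr]; apply.
have x_uv : (coef basis x)@_(u + v) = 0.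
  by apply/eqP/negPn/negP => /x_low; rewrite irr.
split=> [|m]; rewrite xE; first by rewrite eqxx mulr1 x_uv addr0.
by have [->|_] := eqVneq m (u + v)%MM; [left | rewrite mulr0 add0r => /x_low; right].
Qed.

Lemma is_LM_monomial_mul u v :
  is_LM a prec (monomial a u * monomial a v) (u + v)%MM.
Proof. exact/is_LMP/lead_mul. Qed.

(** [mo_factor], applied to a monomial as a multiple of 1, makes 0 the least exponent; [mo_compat]
    with a trivial right factor gives compatibility with addition. *)
Lemma prec_admissible : admissible prec.
Proof.
have [[irr tr tot] wf fac compat] := spa_order hA.
have neq1 u : u != 0%MM -> monomial a u != 1.
  by rewrite -monomial0 (inj_eq monomial_inj).
have prec0 u : u != 0%MM -> prec 0%MM u.
  move=> u0; apply: (fac u 0%MM u 0%MM); first exact: neq1.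
    by rewrite (inj_eq monomial_inj) eq_sym.
  by have := is_LM_monomial_mul u 0%MM; rewrite addm0 monomial0 !mulr1.
(* [mo_compat] excludes the case where the larger product has leading monomial 1. Then [v] is 0, and
   [prec u 0] contradicts the minimality of 0. *)
split=> // u v w uv; have [e|wv0] := eqVneq (w + v)%MM 0%MM.
  have v0 : v = 0%MM by apply/eqP; move/eqP: e; rewrite mnmD_eq0 => /andP[].
  have u0 : u != 0%MM by apply: contraTN uv => /eqP->; rewrite v0 irr.
  by move: (prec0 u u0) uv; rewrite v0 => /tr t /t; rewrite irr.
by apply: (compat u v w 0%MM _ _ uv); rewrite ?monomial0 ?mulr1 ?neq1 //;
  apply: is_LM_monomial_mul.
Qed.

End SolvableFacts.

(** * Division and the leading monomials of syzygies *)

Section Syzygies.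
Variables (K : fieldType) (A : algType K) (n : nat) (a : 'I_n -> A).
Variable prec : rel 'X_{1..n}.
Hypothesis hA : solvable_polynomial_algebra a prec.
Let basis := spa_basis hA.
Local Notation free r := {ffun 'I_r -> A^o}.
Local Notation mono := (monomial a).
Local Notation coord := (coord basis).
Local Notation lead := (lead basis).

(** The monomials of the initial module of the kernel of [f], kept as a predicate. *)
Definition leading r (M : lmodType A) (f : free r -> M) lt p :=
  exists2 v, f v = 0 & lead lt v p.

Lemma lead_cancel r (lt : rel ('X_{1..n} * 'I_r)) v w p : lead lt v p -> lead lt w p ->
  exists2 c : K, c != 0 & forall q, coord q (v - c%:A *: w) != 0 -> lt q p.
Proof.
move=> [vp vmax] [wp wmax]; exists (coord p v / coord p w).
  by rewrite mulf_neq0 ?invr_eq0.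
move=> q; rewrite raddfB /= coordZ; have [->|qp] := eqVneq q p.
  by rewrite divfK // subrr eqxx.
have [vq0|/vmax] := eqVneq (coord q v) 0; last by rewrite (negbTE qp).
rewrite vq0 sub0r oppr_eq0 mulf_eq0 negb_or => /andP[_ /wmax].
by rewrite (negbTE qp).
Qed.

Variables (r s : nat) (M : lmodType A) (f : {linear free r -> M}).
Variable lt : rel ('X_{1..n} * 'I_r).
Hypothesis lt_ok : compatible_order prec lt.
(** The hypotheses below make [g] a Gröbner basis of the kernel of [f], with leading monomials
    [l]. *)
Variables (g : 'I_s -> free r) (l : 'I_s -> 'X_{1..n} * 'I_r).
Hypothesis fg : forall j, f (g j) = 0.
Hypothesis lead_g : forall j, lead lt (g j) (l j).
Hypothesis cover : forall p, leading f lt p -> exists j u, p = shift u (l j).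

(** The leading monomial of the image under [comb g] of the monomial [q], by [lead_target]. *)
Local Notation target q := (shift q.1 (l q.2)).

Lemma f_comb h : f (comb g h) = 0.
Proof. by rewrite linear_sum big1 // => j _; rewrite linearZ /= fg scaler0. Qed.

Lemma ker_closed v w (x y : A) : f v = 0 -> f w = 0 -> f (v - x *: (y *: w)) = 0.
Proof. by move=> fv fw; rewrite scalerA linearB linearZ /= fv fw scaler0 subrr. Qed.

Lemma comb_monomial u j : comb g (mono u *: unit_vector A j) = mono u *: g j.
Proof. by rewrite linearZ /= comb_unit_vector. Qed.

Lemma lead_target u j : lead lt (mono u *: g j) (shift u (l j)).
Proof. exact: (lead_monomial_scale (lead_mul hA) lt_ok). Qed.

Lemma combZ (c : K) (h : free s) : comb g (c%:A *: h) = c%:A *: comb g h.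
Proof. exact: linearZ. Qed.

(** Division by [g]: the leading monomial of [v] is cancelled by a multiple of some [g j], and the
    remainder lies below it, so induction on the bound [p] applies. The bound on targets is what
    controls the syzygies later. *)
Lemma standard_representation p v :
  f v = 0 -> (forall q, coord q v != 0 -> lt q p) ->
  exists2 h, v = comb g h & forall q, coord q h != 0 -> lt (target q) p.
Proof.
have [irr tr _ wf _ _] := lt_ok.
elim/(well_founded_ind wf): p v => p IH v fv v_low.
have [->|v0] := eqVneq v 0.
  by exists 0; [rewrite linear0 | move=> q; rewrite raddf0 eqxx].
have [p' vp'] := lead_exists basis lt_ok (elimN eqP v0).
have [j [u Ep']] : exists j u, p' = shift u (l j) by apply: cover; exists v.
have p'p : lt p' p by apply: v_low; case: vp'.
have wp' : lead lt (mono u *: g j) p' by rewrite Ep'; apply: lead_target.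
have [c c0 low] := lead_cancel vp' wp'.
have [|h Eh h_low] := IH p' p'p (v - c%:A *: (mono u *: g j)) _ low.
  exact: ker_closed.
exists (h + c%:A *: (mono u *: unit_vector A j)).
  by rewrite linearD /= combZ comb_monomial -Eh subrK.
move=> q; rewrite raddfD /= coordZ coord_unit_vector.
have [->|_] := eqVneq q (u, j); first by rewrite -Ep'.
by rewrite mulr0 addr0 => /h_low /tr; apply.
Qed.

(** No strict bound is given, so one cancellation by hand provides it: the remainder lies below the
    leading monomial of [v]. *)
Lemma comb_onto v : f v = 0 -> exists h, comb g h = v.
Proof.
have [_ tr _ _ _ _] := lt_ok.
have [->|v0] := eqVneq v 0; first by exists 0; rewrite linear0.
move=> fv; have [p vp] := lead_exists basis lt_ok (elimN eqP v0).
have [j [u Ep]] : exists j u, p = shift u (l j) by apply: cover; exists v.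
have wp : lead lt (mono u *: g j) p by rewrite Ep; apply: lead_target.
have [c c0 low] := lead_cancel vp wp.
have [|h Eh _] := standard_representation _ low.
  exact: ker_closed.
exists (h + c%:A *: (mono u *: unit_vector A j)).
by rewrite linearD /= combZ comb_monomial -Eh subrK.
Qed.

Lemma leading_syzygy u j :
  leading (comb g) (schreyer lt l) (u, j) <->
  exists2 i : 'I_s, (j < i)%N & divides (l i) (shift u (l j)).
Proof.
have [irr tr _ _ _ _] := lt_ok; split=> [[h gh0 [huj hmax]]|[i ji]].
  (* If another term of [h] has the same target, Schreyer's tie-break gives it a larger index, and
     equality of the targets is the divisibility sought. *)
  have [/hasP[[v i]]|/hasPn noq] :=
      boolP (has (fun q => (q != (u, j)) && (target q == shift u (l j))) (support basis h)).
    rewrite mem_support /= => /hmax; case: eqP => //= _.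
    rewrite /schreyer /= => H /eqP E; move: H; rewrite E irr eqxx /= => ji.
    by exists i => //; apply/dividesP; exists v.
  (* Otherwise all other terms have smaller targets, so nothing cancels the leading monomial of the
     image of [(u, j)], although the image of [h] is 0. *)
  have low q : coord q h != 0 -> q != (u, j) -> lt (target q) (shift u (l j)).
    move=> hq quj; move: (noq q) (hmax q hq).
    rewrite mem_support hq quj /= => /(_ isT) /negbTE E.
    by rewrite (negbTE quj) /schreyer /= E /= orbF.
  have zero m i : coord (m, i) h != 0 -> (m, i) != (u, j) ->
      coord (shift u (l j)) (mono m *: g i) = 0.
    move=> hm muj; apply/eqP/negPn/negP => /(lead_target m i).2.
    have lt1 := low _ hm muj; case/orP => [/eqP e|lt2].
      by rewrite e irr in lt1.
    by have := tr _ _ _ lt1 lt2; rewrite irr.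
  case/negP: (lead_target u j).1; have := congr1 (coord (shift u (l j))) gh0.
  rewrite raddf0 raddf_sum (bigD1 j) //= [X in _ + X]big1 => [|i ij].
    rewrite addr0 (coord_scale _ _ (h j)) (bigD1_seq u) ?msupp_uniq ?mcoeff_msupp //=.
    rewrite big1_seq ?addr0 => [/eqP|m /andP[mu]].
      by rewrite mulf_eq0 => /orP[] // /eqP e; case/eqP: huj.
    rewrite mcoeff_msupp => hm; rewrite zero ?mulr0 //.
    by rewrite xpair_eqE (negbTE mu).
  rewrite (coord_scale _ _ (h i)) big1_seq // => m /=; rewrite mcoeff_msupp => hm.
  by rewrite zero ?mulr0 // xpair_eqE (negbTE ij) andbF.
case/dividesP => v E.
have leadi : lead lt (mono v *: g i) (shift u (l j)) by rewrite E; apply: lead_target.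
have [c c0 low] := lead_cancel (lead_target u j) leadi.
have [|h Eh h_low] := standard_representation _ low.
  by apply: ker_closed; rewrite // linearZ /= fg scaler0.
have vi_uj : (v, i) != (u, j).
  by apply: contraTneq ji => -[_ ->]; rewrite ltnn.
have coordE q : coord q (mono u *: unit_vector A j -
      c%:A *: (mono v *: unit_vector A i) - h) =
    (q == (u, j))%:R - c * (q == (v, i))%:R - coord q h.
  by rewrite !raddfB /= coordZ !coord_unit_vector.
(* The coordinate at [(u, j)] is 1; [(v, i)] has the same target and a larger index, and the terms
   of [h] have smaller targets. *)
exists (mono u *: unit_vector A j - c%:A *: (mono v *: unit_vector A i) - h).
  by rewrite !linearB /= combZ !comb_monomial Eh subrr.
split=> [|q]; rewrite coordE.
  rewrite eqxx [(u, j) == _]eq_sym (negbTE vi_uj) mulr0 subr0.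
  suff -> : coord (u, j) h = 0 by rewrite subr0 oner_eq0.
  by apply/eqP/negPn/negP => /h_low; rewrite irr.
have [//|quj] := eqVneq q (u, j).
have [-> _|qvi] := eqVneq q (v, i).
  by rewrite /schreyer /= E irr eqxx.
rewrite mulr0 subr0 sub0r oppr_eq0 => /h_low lt_q.
by rewrite /schreyer lt_q.
Qed.

End Syzygies.

(** * From iterated kernels to finite free resolutions *)

Section Resolving.
Variables (K : fieldType) (A : algType K).
Local Notation free r := {ffun 'I_r -> A^o}.

(** A resolution of length [q] of the image of [f], which need not be all of [M]. The recursion
    postpones families of modules indexed by degree. *)
Fixpoint resolves q r (M : lmodType A) (f : {linear free r -> M}) : Prop :=
  if q is q'.+1 then
    exists s (g : {linear free s -> free r}),
      (forall x, f x = 0 <-> exists y, g y = x) /\ resolves q' g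
  else injective f.

Lemma free_of_finite_rank_ffun r : free_of_finite_rank (free r).
Proof.
exists r, (@unit_vector K A r) => x; exists x.
split=> [|c ->]; first exact: sum_unit_vectors.
by rewrite -sum_unit_vectors.
Qed.

(** The second clause compares images because [L 0] is abstract; exactness at the joint needs no
    more. *)
Lemma resolves_chain q r (M : lmodType A) (f : {linear free r -> M}) :
  resolves q f ->
  exists (L : nat -> lmodType A) (phi : forall i, {linear L i -> res_target M L i}),
  [/\ forall i, (i <= q)%N -> free_of_finite_rank (L i),
      forall y, (exists x, phi 0%N x = y) <-> exists x, f x = y,
      forall i, (i < q)%N -> forall x : L i,
        phi i x = 0 <-> exists y : L i.+1, phi i.+1 y = x &
      injective (phi q)].
Proof.
elim: q r M f => [|q IH] r M f /=.
  move=> f_inj.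
  (* Degrees above 0 are fillers, with zero maps. *)
  exists (fun=> free r).
  exists (fun i => match i return {linear free r -> res_target M (fun=> free r) i} with
                   | 0 => f | _.+1 => \0 end).
  by split=> // i _; apply: free_of_finite_rank_ffun.
move=> [s [g [fg /IH[L [phi [Lfree im_phi exact_phi inj_phi]]]]]].
(* [res_target] doubles as the shift that puts [free r] in front of [L]. *)
exists (res_target (free r) L).
exists (fun i => match i return
    {linear res_target (free r) L i -> res_target M (res_target (free r) L) i} with
    | 0 => f | j.+1 => phi j end).
split=> //.
- by case=> [|i] //= iq; [apply: free_of_finite_rank_ffun | apply: Lfree].
- case=> [|i] iq x /=; last exact: exact_phi.
  by split=> [/fg/im_phi|/im_phi/fg].
Qed.

Lemma resolves_resolution q r (M : lmodType A) (f : {linear free r -> M}) :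
  resolves q f -> (forall y, exists x, f x = y) ->
  exists (L : nat -> lmodType A) (phi : forall i, {linear L i -> res_target M L i}),
    finite_free_resolution q phi.
Proof.
move=> /resolves_chain[L [phi [Lfree im_phi exact_phi inj_phi]]] f_onto.
by exists L, phi; split=> // y; apply/im_phi.
Qed.

End Resolving.

(** * Elimination of the variables and the bound on the length *)

Section HilbertSyzygy.
Variables (K : fieldType) (A : algType K) (n : nat) (a : 'I_n -> A).
Variable prec : rel 'X_{1..n}.
Hypothesis hA : solvable_polynomial_algebra a prec.
Local Notation free r := {ffun 'I_r -> A^o}.
Local Notation leading := (leading hA).

Definition drop_vars k (m : 'X_{1..n}) : 'X_{1..n} :=
  [multinom if (i < k)%N then 0%N else m i | i < n].

(** For a set stable under [shift], this means that it is generated by monomials without the first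
    [k] variables. *)
Definition free_of_vars k r (P : 'X_{1..n} * 'I_r -> Prop) :=
  forall m i, P (m, i) -> P (drop_vars k m, i).

Lemma minimal_free_of_vars k r (P : 'X_{1..n} * 'I_r -> Prop) p (i : 'I_n) :
  free_of_vars k P -> minimal P p -> (i < k)%N -> p.1 i = 0%N.
Proof.
case: p => m c kP [/= /kP Pm /(_ _ Pm) Pmin ik].
have /Pmin[<-] : divides (drop_vars k m, c) (m, c).
  rewrite /divides eqxx /=; apply/mnm_lepP => j; rewrite mnmE.
  by case: ifP.
by rewrite mnmE ik.
Qed.

(* Listing the minimal generators by decreasing degree in the k-th variable
   makes that variable disappear from the leading monomials of the syzygies. *)
Lemma syzygy_step k r (M : lmodType A) (f : {linear free r -> M}) lt :
  (k < n)%N -> compatible_order prec lt -> free_of_vars k (leading f lt) ->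
  exists s (g : {linear free s -> free r}) lt',
  [/\ compatible_order prec lt', forall x, f x = 0 <-> exists y, g y = x,
      free_of_vars k.+1 (leading g lt') & forall i, ~ leading g lt' (0%MM, i)].
Proof.
move=> kn lt_ok kf; pose ko := Ordinal kn.
have [S0 uS0 S0P] := minimal_elements (leading f lt).
pose le (p q : 'X_{1..n} * 'I_r) := (q.1 ko <= p.1 ko)%N.
pose S := sort le S0; pose l (j : 'I_(size S)) := tnth (in_tuple S) j.
have Smin j : minimal (leading f lt) (l j).
  by apply/S0P; rewrite -(mem_sort le); apply: mem_tnth.
have l_inj : injective l by apply/tuple_uniqP; rewrite sort_uniq.
have l_sorted (i j : 'I_(size S)) : (i < j)%N -> le (l i) (l j).
  move=> ij; rewrite /l !(tnth_nth (l i)) /=.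
  apply: (sorted_ltn_nth (leT := le)); rewrite ?inE //.
    by move=> y x z; rewrite /le => xy yz; apply: leq_trans yz xy.
  by apply: sort_sorted => x y; apply: leq_total.
have [|g gP] := @fin_all_exists _ _
    (fun j v => f v = 0 /\ lead (spa_basis hA) lt v (l j)).
  by move=> j; have [[v fv vl] _] := Smin j; exists v.
have cover p : leading f lt p -> exists j u, p = shift u (l j).
  move=> /minimal_below[q /S0P qS qp].
  have /tnthP[j Ej] : q \in in_tuple S by rewrite mem_sort.
  by have [u ->] := dividesP _ _ qp; exists j, u; rewrite Ej.
have fg j := (gP j).1; have lead_g j := (gP j).2.
have lsP := leading_syzygy lt_ok fg lead_g cover.
exists (size S), (comb g), (schreyer lt l); split.
- exact: schreyer_compatible (prec_admissible hA) lt_ok.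
- move=> x; split=> [fx|[y <-]]; last exact: f_comb.
  exact: (comb_onto lt_ok fg lead_g cover fx).
- move=> m j /lsP[i ji /andP[/eqP e /mnm_lepP le_im]]; apply/lsP; exists i => //.
  rewrite /divides e eqxx /=; apply/mnm_lepP => c.
  (* Variables before [k] do not occur in [l i]; the degree of [l i] in variable [k] is at most that
     of [l j] by the sorting; later exponents of [m] are unchanged. *)
  move: (le_im c); rewrite /= !mnmDE mnmE ltnS.
  case: (ltngtP c k) => // ck _.
    by rewrite (minimal_free_of_vars kf (Smin i) ck).
  by have -> : c = ko; [apply: val_inj | apply: l_sorted].
(* Here [l i] would divide the minimal [l j], hence equal it, although [i] and [j] differ. *)
- move=> j /lsP[i ji]; rewrite /shift add0m -surjective_pairing => dij.
  have [Pi _] := Smin i; have [_ /(_ _ Pi dij)/l_inj e] := Smin j.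
  by rewrite e ltnn in ji.
Qed.

(** [d] counts the remaining steps. The last hypothesis is conditional because the initial map may
    violate it, while each step ensures it for the next map. *)
Lemma resolves_free_of_vars d k r (M : lmodType A) (f : {linear free r -> M}) lt :
  (k + d)%N = n -> compatible_order prec lt -> free_of_vars k (leading f lt) ->
  (d = 0%N -> forall i, ~ leading f lt (0%MM, i)) -> resolves d f.
Proof.
elim: d k r M f lt => [|d IH] k r M f lt kdn lt_ok kf nf /=.
  (* Now [k] is [n]: dropping all variables from the leading monomial of a nonzero kernel element
     leaves a basis element, which is excluded. *)
  apply: raddf_inj => x fx; apply: NNPP => /(lead_exists (spa_basis hA) lt_ok)[[m i] xm].
  apply: (nf erefl i); have : leading f lt (m, i) by exists x.
  move/kf; congr (leading f lt (_, i)).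
  by apply/mnmP => j; rewrite mnmE mnm0E -[k]addn0 kdn ltn_ord.
have [|s [g [lt' [ok' fg kg ng]]]] := syzygy_step _ lt_ok kf.
  by rewrite -kdn addnS ltnS leq_addr.
by exists s, g; split=> //; apply: (IH k.+1 _ _ g lt'); rewrite // addSnnS.
Qed.

(** Linear algebra over K: a nontrivial relation has an invertible coefficient, so one generator is
    redundant; induction on their number. *)
Lemma injective_generators m (M : lmodType A) (g : 'I_m -> M) : n = 0%N ->
  (forall y, exists x, comb g x = y) ->
  exists r (h : 'I_r -> M), injective (comb h) /\ forall y, exists x, comb h x = y.
Proof.
move=> n0; elim: m g => [|m IH] g g_onto.
  by exists 0%N, g; split=> // x y _; apply/ffunP => -[].
have [ker0|ker] := classic (forall x, comb g x = 0 -> x = 0).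
  by exists m.+1, g; split=> //; apply: raddf_inj.
have [x gx x0] : exists2 x, comb g x = 0 & x <> 0.
  by apply: NNPP => nex; apply: ker => x gx; apply: NNPP => x0; apply: nex; exists x.
have [i xi0] : exists i, x i <> 0.
  apply: NNPP => nex; apply: x0; apply/ffunP => i; rewrite ffunE.
  by apply: NNPP => xi; apply: nex; exists i.
(* Without variables the only exponent is 0, so every element of A is a scalar. *)
have [c Ec] : exists c : K, x i = c%:A.
  have [p ->] := (spa_basis hA).1 (x i); rewrite lincomb_mmap.
  exists p@_0%MM; rewrite {1}(_ : p = p@_0 *: 'X_[0]) ?mmapZ ?mmapX ?mmap11 ?mulr1 //.
  apply/mpolyP => u; rewrite mcoeffZ mcoeffX.
  have -> : u = 0%MM by apply/mnmP => j; case: (j) => ? /[dup]; rewrite {1}n0.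
  by rewrite eqxx mulr1.
have c0 : c != 0 by apply/eqP => e; apply: xi0; rewrite Ec e scale0r.
have gi : g i = - (\sum_(j < m) (c^-1)%:A * x (lift i j) *: g (lift i j)).
  apply/eqP; rewrite -addr_eq0; move: gx; rewrite /comb (bigD1_ord i) //= Ec.
  move/(congr1 (fun y => (c^-1)%:A *: y)).
  rewrite scaler0 scalerDr scalerA mulr_algl scalerA mulVf // scale1r scale1r => E.
  apply/eqP; rewrite -[RHS]E scaler_sumr; congr (_ + _).
  by apply: eq_bigr => j _; rewrite scalerA.
apply: (IH (fun j => g (lift i j))) => y; have [z <-] := g_onto y.
(* The relation solved for [g i] is substituted into the combination [z]. *)
exists [ffun j => z (lift i j) - z i * ((c^-1)%:A * x (lift i j))].
rewrite /comb (bigD1_ord i) //= gi scalerN scaler_sumr addrC -sumrB.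
by apply: eq_bigr => j _; rewrite ffunE scalerBl scalerA.
Qed.

End HilbertSyzygy.

Theorem theorem3p2p2 (K : fieldType) (A : algType K) (n : nat)
    (a : 'I_n -> A) (prec : rel 'X_{1..n})
    (hA : solvable_polynomial_algebra a prec)
    (M : lmodType A) (hM : finitely_generated M) :
  exists (q : nat) (L : nat -> lmodType A)
    (phi : forall i : nat, {linear L i -> res_target M L i}),
    (q <= n)%N /\ finite_free_resolution q phi.
Proof.
have [m [g g_gen]] := hM.
have g_onto y : exists x : {ffun 'I_m -> A^o}, comb g x = y.
  have [c ->] := g_gen y; exists [ffun i => c i].
  by apply: eq_bigr => i _; rewrite ffunE.
suff [r [f [f_res f_onto]]] : exists r (f : {linear {ffun 'I_r -> A^o} -> M}),
    resolves n f /\ forall y, exists x, f x = y.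
  by have [L [phi H]] := resolves_resolution f_res f_onto; exists n, L, phi.
(* The length is [n] in both cases. Without variables no syzygy step is made, so the generators must
   already be independent. *)
have [n0|n0] := posnP n.
  have [r [h [h_inj h_onto]]] := injective_generators hA n0 g_onto.
  by exists r, (comb h); rewrite n0.
exists m, (comb g); split=> //.
have adm := prec_admissible hA.
(* Schreyer's order for a constant family over the rank one order compares exponents by [prec] and
   breaks ties by the index. *)
have lt_ok := schreyer_compatible (fun _ : 'I_m => (0%MM, ord0)) adm
  (base_order_compatible adm).
apply: (resolves_free_of_vars (hA := hA) (add0n n) lt_ok).
- move=> u i; congr (leading _ _ _ (_, i)).
  by apply/mnmP => j; rewrite mnmE.
- by move=> e; rewrite e in n0.
Qed.
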